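(* Let $\sum_{n\in\mathbb{N}} a^1_n$, $\sum_{n\in\mathbb{N}} a^2_n$ and $\sum_{n\in\mathbb{N}} a^3_n$ be any three conditionally convergent series of real numbers. Then there is a set $A\subseteq\mathbb{N}$ that sends all three series to infinity; that is, for each $i\in\{1,2,3\}$, the subseries $\sum_{n\in A}a^i_n$ sums either to $\infty$ or to $-\infty$.
   Context: A series $\sum_{n\in\mathbb{N}}a_n$ of real numbers is conditionally convergent if it converges (to a real number) but $\sum_{n\in\mathbb{N}}|a_n|$ does not converge. For $A\subseteq\mathbb{N}$, $\sum_{n\in A}a_n$ denotes the subseries consisting only of those terms with index in $A$, taken in increasing order of the index. A set $A\subseteq\mathbb{N}$ sends $\sum_{n\in\mathbb{N}}a_n$ to infinity if the partial sums of $\sum_{n\in A}a_n$ tend to $\infty$ or tend to $-\infty$. The sign of the infinity may depend on the series. *)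

(* Defs.v *)
From HB Require Import structures.
From mathcomp Require Import all_boot all_order all_algebra.
From mathcomp Require Import all_classical all_reals all_analysis.

Set Implicit Arguments.
Unset Strict Implicit.
Unset Printing Implicit Defensive.

Import Order.TTheory GRing.Theory Num.Theory.
Import numFieldNormedType.Exports.

Local Open Scope classical_set_scope.
Local Open Scope ring_scope.

Definition conditionally_convergent (R : realType) (a : R^nat) : Prop :=
  cvgn (series a) /\ ~ cvgn [normed series a].

Definition increasing_enumeration (A : set nat) (e : nat^nat) : Prop :=
  increasing_seq e /\ range e = A.

(* The partial sums of the subseries over A are those of the terms a (e k),
   where e lists A in increasing order.  Such an e exists exactly when A is
   infinite, and is then unique; a finite A gives a finite sum, which does not
   tend to infinity, in accordance with the existential being false. *)
Definition sends_to_infinity (R : realType) (A : set nat) (a : R^nat) : Prop :=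
  exists e : nat^nat, increasing_enumeration A e /\
    (series (a \o e) @ \oo --> +oo \/ series (a \o e) @ \oo --> -oo).

(* Main.v *)
Require Import Defs.
From mathcomp Require Import all_boot all_order all_algebra.
From mathcomp Require Import all_classical all_reals all_analysis.
From mathcomp Require Import ring lra zify.

Import Order.TTheory GRing.Theory Num.Theory.
Import numFieldNormedType.Exports.

Local Open Scope classical_set_scope.
Local Open Scope ring_scope.

(** It suffices to find weights [w n] in [0, 1] for which the three weighted
series [\sum w n * a i n] tend to plus or minus infinity: the weights can then be rounded to
0 and 1 so that all partial sums of all three series change by a bounded amount
([prefix_rounding], the signed-series argument of Barany and Grinberg).  Since
the series themselves converge, adding a constant to the weights changes the
partial sums by a bounded amount, so [w = (1 + u) / 2] works as soon as [u],
with values in [-1, 1], makes the [\sum u n * a i n] infinite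
([round_signed_sum]).  Thus terms may be counted with the sign -1 as well.

Put [n] and [m] in the same class when the vectors [(a i n)_i] and [(a i m)_i]
have the same sign pattern up to a global sign, 0 counting as positive.  Giving
each [n] in a class the sign of [a 0 n] makes every coordinate of a term have
constant sign along that class, so that coordinate [i] contributes plus or minus the partial sums of the
[`|a i n|] over the class.  Let [D j] be the set of coordinates for which the
class [j] contributes an infinite amount.  As no series converges absolutely and
the classes are finite in number, the sets [D j] cover the three coordinates.
It remains to select some classes, each with a sign, whose [D j] still cover, and
such that any two selected classes agree on the sign of the coordinates that
they share; every other class gets the value 0 of [u].  For three coordinates
this is always possible ([coherent_cover]): either one [D j] is everything; or
two proper subsets cover, one of them with two elements, and they share at most
one coordinate, on which one global sign change makes them agree; or all [D j]
have at most one element and nothing is shared by two of them. *)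

(** * Rounding weights with bounded prefix errors *)

Definition settled {R : numDomainType} (t : R) : bool := (t == 0) || (t == 1).

(** Follow the line from [x] in the direction [z] up to the last moment before it
leaves the cube; the coordinate about to leave is then 0 or 1. *)
Lemma line_exits_cube {R : realFieldType} {I : finType} (x z : I -> R) (i1 : I) :
  (forall i, 0 <= x i <= 1) -> z i1 != 0 ->
  exists t, (forall i, 0 <= x i + t * z i <= 1) /\
    exists i, settled (x i + t * z i).
Proof.
move=> x01 z1.
(* The nonnegative time at which coordinate [i] leaves [0, 1]. *)
pose T i := (if 0 < z i then 1 - x i else x i) / `|z i|.
have T0 i : 0 <= T i.
  by rewrite /T; case: ifP => _; rewrite divr_ge0 //; have := x01 i; lra.
case: (@arg_minP _ _ _ i1 (fun i => z i != 0) T z1) => i0 zi0 Tmin.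
exists (T i0); split.
  move=> i; have [->|zi] := eqVneq (z i) 0; first by rewrite mulr0 addr0.
  have := Tmin _ zi; rewrite {2}/T ler_pdivlMr ?normr_gt0 // => le_t.
  have Tz0 : 0 <= T i0 * `|z i| by rewrite mulr_ge0.
  have := x01 i; case: ltP le_t Tz0 => sz.
    rewrite gtr0_norm //; lra.
  rewrite ler0_norm // mulrN; lra.
exists i0; rewrite /settled {1 2}/T; apply/orP.
case: ltP => sz; [right|left]; apply/eqP.
  by rewrite gtr0_norm // divfK // addrC subrK.
by rewrite ler0_norm // invrN mulrN mulNr divfK // subrr.
Qed.

(** Any [d.+1] vectors in dimension [d] satisfy a nontrivial linear relation, and
moving the coefficients along that relation does not change the combination. *)
Lemma dependent_vectors_settle {R : realFieldType} {d : nat}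
    (x : 'I_d.+1 -> R) (u : 'I_d.+1 -> 'rV[R]_d) :
  (forall i, 0 <= x i <= 1) ->
  exists y : 'I_d.+1 -> R, [/\ forall i, 0 <= y i <= 1,
    \sum_i y i *: u i = \sum_i x i *: u i & exists i, settled (y i)].
Proof.
move=> x01; pose U := \matrix_i u i.
have : kermx U != 0.
  rewrite kermx_eq0 /row_free neq_ltn ltnS.
  by rewrite (leq_trans (rank_leq_col U)).
case/rowV0Pn => z /sub_kermxP zU /rV0Pn [i1 zi1].
have [t [y01 ysettled]] := line_exits_cube x (z 0) i1 x01 zi1.
exists (fun i => x i + t * z 0 i); split => //.
under eq_bigr do rewrite scalerDl -scalerA.
rewrite big_split /= -scaler_sumr.
suff -> : \sum_i z 0 i *: u i = 0 by rewrite scaler0 addr0.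
by rewrite -[RHS]zU mulmx_sum_row; under [RHS]eq_bigr do rewrite rowK.
Qed.

(** The indices below [k] with a coefficient other than 0 and 1 are floating.  As
soon as there are [d.+1] of them, a linear relation between their vectors
settles at least one more, without touching the coefficients already settled. *)
Lemma rounding_step {R : realFieldType} {d : nat} (v : nat -> 'rV[R]_d)
    (x : R^nat) (k : nat) :
  (forall n, 0 <= x n <= 1) ->
  (count (fun n => ~~ settled (x n)) (iota 0 k) <= d.+1)%N ->
  exists x' : R^nat, [/\ forall n, 0 <= x' n <= 1,
    forall n, settled (x n) || (k <= n)%N -> x' n = x n,
    (count (fun n => ~~ settled (x' n)) (iota 0 k) <= d)%N &
    \sum_(0 <= n < k) x' n *: v n = \sum_(0 <= n < k) x n *: v n].
Proof.
move=> x01; rewrite leq_eqVlt => /predU1P[floats|]; last by exists x.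
set F := [seq n <- iota 0 k | ~~ settled (x n)].
have szF : size F = d.+1 by rewrite size_filter.
have uF : uniq F by rewrite filter_uniq ?iota_uniq.
have memF n : (n \in F) = ~~ settled (x n) && (n < k)%N.
  by rewrite mem_filter mem_iota.
pose f (i : 'I_d.+1) := nth 0%N F i.
have fF i : f i \in F by rewrite mem_nth // szF.
have [y [y01 ysum [i0 yi0]]] :=
  dependent_vectors_settle (x \o f) (v \o f) (fun i => x01 (f i)).
pose x' n := if n \in F then y (inord (index n F)) else x n.
have x'f i : x' (f i) = y i.
  by rewrite /x' fF index_uniq ?szF // inord_val.
exists x'; split.
- by move=> n; rewrite /x'; case: ifP.
- by move=> n; rewrite /x' memF; case: (settled _) => //= kn; rewrite ltnNge kn.
- have -> : d = size (rem (f i0) F) by rewrite size_rem // szF.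
  rewrite -size_filter; apply: uniq_leq_size.
    by rewrite filter_uniq ?iota_uniq.
  move=> n; rewrite mem_filter mem_iota /= => /andP[nset nk].
  rewrite mem_rem_uniq // inE; apply/andP; split.
    by apply: contraNneq nset => ->; rewrite x'f.
  by apply: contraNT nset => nF; rewrite /x' (negbTE nF);
    move: nF; rewrite memF nk andbT negbK.
- have sumF (g : R^nat) : \sum_(n <- F) g n *: v n = \sum_i g (f i) *: v (f i).
    by rewrite (big_nth 0%N) szF big_mkord.
  have split_sum (g : R^nat) : \sum_(0 <= n < k) g n *: v n =
      \sum_(n <- F) g n *: v n + \sum_(0 <= n < k | settled (x n)) g n *: v n.
    rewrite (bigID (fun n => settled (x n))) /= addrC; congr (_ + _).
    by rewrite /F big_filter /index_iota subn0.
  rewrite !split_sum; congr (_ + _).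
    by rewrite !sumF -ysum; apply: eq_bigr => i _; rewrite x'f.
  by apply: eq_bigr => n sn; rewrite /x' memF sn.
Qed.

(** Admit the indices one at a time, starting from the weights [w] and applying
[rounding_step] after each admission.  A settled coefficient never changes
again, so the coefficients of stage [N] below [N] agree with the final choice
[A] except at the at most [d] floating ones, while the prefix sum of stage [N] is
exactly that of [w].  An index that floats forever may be left out of [A]. *)
Lemma prefix_rounding {R : realType} {d : nat} (v : nat -> 'rV[R]_d)
    (w : R^nat) (M : R) :
  (forall n j, `|v n 0 j| <= M) -> (forall n, 0 <= w n <= 1) ->
  exists A : pred nat, forall j N,
    `|\sum_(0 <= n < N) ((A n)%:R - w n) * v n 0 j| <= d%:R * M.
Proof.
move=> vM w01.
pose inv k (x : R^nat) := [/\ forall n, 0 <= x n <= 1,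
  forall n, (k <= n)%N -> x n = w n,
  (count (fun n => ~~ settled (x n)) (iota 0 k) <= d)%N &
  \sum_(0 <= n < k) x n *: v n = \sum_(0 <= n < k) w n *: v n].
have step k x : exists x', inv k x ->
    inv k.+1 x' /\ forall n, settled (x n) -> x' n = x n.
  have [|//] := pselect (inv k x); last by exists x.
  move=> [x01 xw xF xsum].
  have [|x' [x'01 x'x x'F x'sum]] := rounding_step v x k.+1 x01.
    by rewrite -addn1 iotaD count_cat /= addn0 -(addn1 d) leq_add // leq_b1.
  exists x' => _; split; last by move=> n sn; rewrite x'x ?sn.
  split => //.
    by move=> n kn; rewrite x'x ?kn ?orbT // xw // ltnW.
  by rewrite x'sum !big_nat_recr //= xsum xw.
(* [step] holds vacuously outside [inv], so that [next] is a total function. *)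
have {step}[next nextP] := choice (fun p : nat * (R^nat) => step p.1 p.2).
pose x k := iteri k (fun k y => next (k, y)) w.
have invx k : inv k (x k).
  elim: k => [|k IH]; last by have [] := nextP (k, x k) IH.
  by split => //; rewrite !big_geq.
have xstay k m n : (k <= m)%N -> settled (x k n) -> x m n = x k n.
  move=> km sn; elim: m km => [|m IH]; first by rewrite leqn0 => /eqP->.
  rewrite leq_eqVlt => /predU1P[->//|]; rewrite ltnS => /IH xm.
  by have [_ /(_ n)] := nextP (m, x m) (invx m); rewrite /= -xm => -> //; rewrite xm.
pose A n := `[< exists k, x k n = 1 >].
have AE k n : settled (x k n) -> (A n)%:R = x k n.
  move=> sn; rewrite /A; case: asboolP => [[m xm]|nx].
    have sm : settled (x m n) by rewrite /settled xm eqxx orbT.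
    by have [km|/ltnW mk] := leqP k m;
      [rewrite -(xstay _ _ _ km sn)
      |rewrite (xstay _ _ _ mk sm)].
  case/orP: (sn) => /eqP xk; first by rewrite xk.
  by case: nx; exists k.
exists A => j N.
have [x01 _ xF xsum] := invx N.
have -> : \sum_(0 <= n < N) ((A n)%:R - w n) * v n 0 j =
          \sum_(0 <= n < N | ~~ settled (x N n)) ((A n)%:R - x N n) * v n 0 j.
  move/rowP/(_ j): xsum; rewrite !summxE => xsum.
  transitivity (\sum_(0 <= n < N) ((A n)%:R - x N n) * v n 0 j).
    under eq_bigr do rewrite mulrBl.
    under [RHS]eq_bigr do rewrite mulrBl.
    rewrite !sumrB; congr (_ - _).
    move: xsum; under eq_bigr do rewrite mxE.
    by under [in X in _ = X -> _]eq_bigr do rewrite mxE.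
  rewrite (bigID (fun n => settled (x N n))) /= big1 ?add0r // => n sn.
  by rewrite (AE _ _ sn) subrr mul0r.
have M0 : 0 <= M := le_trans (normr_ge0 _) (vM 0%N j).
apply: le_trans (ler_norm_sum _ _ _) _.
apply: (@le_trans _ _ (\sum_(0 <= n < N | ~~ settled (x N n)) M)).
  apply: ler_sum => n _; rewrite normrM -[leRHS]mul1r ler_pM //.
  by have := x01 n; case: (A n) => /=; rewrite ler_norml; lra.
rewrite big_const_seq iter_addr_0 mulr_natl /index_iota subn0.
exact: ler_wpMn2l.
Qed.

(** * Coherent signs on three coordinates *)

(** [D j] is the set of coordinates that matter for [j], and [sg j] their signs; a
choice of [b j] flips all of these at once.  The three cases depend on the
largest size of a [D j]; the only conflict that can arise is at a single
coordinate shared by two sets, and one flip resolves it. *)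
Lemma coherent_cover {J : finType} (sg : J -> 'I_3 -> bool)
    (D : J -> {set 'I_3}) :
  (forall i, exists j, i \in D j) ->
  exists (C : {set J}) (b : J -> bool) (tau : 'I_3 -> bool),
    (forall i j, j \in C -> i \in D j -> b j (+) sg j i = tau i) /\
    (forall i, exists2 j, j \in C & i \in D j).
Proof.
move=> cover.
have [/existsP[j /eqP Dj]|/existsPn nofull] := boolP [exists j, D j == [set: 'I_3]%SET].
  exists [set j]%SET, (fun=> false), (sg j); split; first by move=> i k /set1P ->.
  by move=> i; exists j; rewrite ?set11 // Dj inE.
have card_le2 j : (#|D j| <= 2)%N.
  have : D j \proper [set: 'I_3]%SET by rewrite properT; exact: nofull j.
  by move/proper_card; rewrite cardsT card_ord.
have [/existsP[j Dj2]|/existsPn small] := boolP [exists j, #|D j| == 2].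
  have : #|~: D j| == 1%N by rewrite cardsCs finset.setCK card_ord (eqP Dj2).
  case/cards1P => m Cj; have mDj : m \notin D j by rewrite -finset.in_setC Cj set11.
  have [k mk] := cover m.
  have jk : k != j by apply: contraNneq mDj => <-.
  have : (#|D j :&: D k| <= 1)%N.
    have : D j :|: D k = [set: 'I_3]%SET.
      apply/setP => i; rewrite !inE; have [//|] := boolP (i \in D j).
      by rewrite -finset.in_setC Cj => /set1P ->.
    move/(congr1 (fun X : {set _} => #|X|)); rewrite cardsU cardsT card_ord.
    have := card_le2 k; have := subset_leq_card (finset.subsetIl (D j) (D k)).
    by rewrite (eqP Dj2); lia.
  move=> Djk.
  have [beta betaP] : exists beta, forall i, i \in D j -> i \in D k ->
      beta (+) sg k i = sg j i.
    have [jk0|[i]] := set_0Vmem (D j :&: D k).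
      exists false => i ij ik.
      by have := finset.in_set0 i; rewrite -jk0 inE ij ik.
    rewrite inE => /andP[ij ik]; exists (sg j i (+) sg k i) => i' i'j i'k.
    have /(_ i' i)-> := card_le1_eqP Djk; rewrite ?inE ?ij ?ik ?i'j ?i'k //.
    by rewrite addbK.
  exists [set j; k]%SET, (fun l => if l == k then beta else false),
    (fun i => if i \in D j then sg j i else beta (+) sg k i); split.
    move=> i l /set2P[] -> il; first by rewrite eq_sym (negbTE jk) il.
    by rewrite eqxx; case: ifP => // ij; exact: betaP.
  move=> i; have [ij|] := boolP (i \in D j); first by exists j; rewrite ?set21.
  by rewrite -finset.in_setC Cj => /set1P ->; exists k; rewrite ?set22.
have [f fP] := choice cover.
exists [set f i | i : 'I_3]%SET, (fun=> false), (fun i => sg (f i) i); split.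
  move=> i _ /imsetP[i' _ ->] ifi'.
  have /card_le1_eqP/(_ i i') -> // : (#|D (f i')| <= 1)%N.
  by have := card_le2 (f i'); rewrite leq_eqVlt (negbTE (small _)).
by move=> i; exists (f i); rewrite ?imset_f.
Qed.

(** * Subseries over an infinite set of indices *)

(** The enumeration jumps from each element of [A] to the next one; the terms
skipped in between carry the factor 0. *)
Lemma enumerate_unbounded (A : pred nat) :
  (forall m, exists2 n, (m <= n)%N & A n) ->
  exists e : nat^nat, [/\ increasing_enumeration [set n | A n] e,
    forall k, (k <= e k)%N &
    forall (R : realType) (a : R^nat) k,
      series (a \o e) k = \sum_(0 <= n < e k) (A n)%:R * a n].
Proof.
move=> unb.
have ex m : exists n, (m <= n)%N && A n.
  by have [n mn An] := unb m; exists n; rewrite mn.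
pose nxt m := ex_minn (ex m).
have nxtP m : [/\ (m <= nxt m)%N, A (nxt m) &
    forall n, (m <= n < nxt m)%N -> ~~ A n].
  rewrite /nxt; case: ex_minnP => n /andP[mn An] nmin; split=> // p /andP[mp].
  by rewrite ltnNge; apply: contra => Ap; apply: nmin; rewrite mp.
pose e k := iter k (fun m => nxt m.+1) (nxt 0%N).
have e_lt k : (e k < e k.+1)%N by case: (nxtP (e k).+1).
have e_ge k : (k <= e k)%N.
  by elim: k => [//|k IH]; exact: leq_ltn_trans IH (e_lt k).
have Ae k : A (e k) by case: k => [|k] /=; [case: (nxtP 0%N)|case: (nxtP (e k).+1)].
have gap k n : (e k < n < e k.+1)%N -> ~~ A n.
  by case: (nxtP (e k).+1) => _ _; exact.
have gap0 n : (n < e 0%N)%N -> ~~ A n by case: (nxtP 0%N) => _ _; exact.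
exists e; split => //; first split.
- by apply/increasing_seqP.
- apply/seteqP; split=> [_ [k _ <-]|n /= An]; first exact: Ae.
  have below k : (n < e k)%N -> range e n.
    elim: k => [/gap0|k IH nk]; first by rewrite An.
    have [/IH//|en|->] := ltngtP n (e k); last by exists k.
    by have := gap k n; rewrite en nk An => /(_ isT).
  exact: below n.+1 (e_ge n.+1).
- move=> R a k.
  have zero m p : (forall n, (m <= n < p)%N -> ~~ A n) ->
      \sum_(m <= n < p) (A n)%:R * a n = 0.
    by move=> nA; rewrite big_nat big1 // => n /nA/negbTE->; rewrite mul0r.
  rewrite /series /=; elim: k => [|k IH].
    by rewrite big_geq // zero.
  rewrite big_nat_recr //= IH.
  rewrite [RHS](@big_cat_nat _ _ _ (e k)) //=; last exact: ltnW.
  rewrite [X in _ = _ + X]big_ltn // (zero (e k).+1) ?addr0 ?Ae ?mul1r //.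
exact: gap.
Qed.

(** Divergence of the masked sums forces [A] to be infinite; along the enumeration
[e] of [A], the partial sums of the subseries are the masked sums at the times
[e k], which tend to infinity. *)
Lemma sends_to_infinity_signed {R : realType} (A : pred nat) (a : R^nat)
    (tau : bool) :
  (fun N => (-1) ^+ tau * \sum_(0 <= n < N) (A n)%:R * a n) @ \oo --> +oo ->
  sends_to_infinity [set n | A n] a.
Proof.
set S := (X in X @ \oo --> _) => Soo.
have unb m : exists2 n, (m <= n)%N & A n.
  apply: contrapT => noA.
  have Sconst N : (m <= N)%N -> S N = S m.
    move=> mN; rewrite /S (@big_cat_nat _ _ _ m 0 N) //=.
    congr (_ * _); rewrite -[RHS]addr0; congr (_ + _).
    rewrite big_nat_cond big1 // => n.
    rewrite andbT => /andP[mn _]; case: (boolP (A n)) => [An|_].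
      by case: noA; exists n.
    by rewrite mul0r.
  have [N _ /(_ (maxn m N) (leq_maxr _ _))] := (cvgryPgt _).1 Soo (S m).
  by rewrite /= Sconst ?leq_maxl // ltxx.
have [e [enum e_ge sumE]] := enumerate_unbounded A unb.
exists e; split=> //.
have eoo : e @ \oo --> \oo.
  by apply/cvgnyPge => m; exists m => // k /= mk; exact: leq_trans (e_ge k).
have Seoo : (S \o e) @ \oo --> +oo := cvg_comp _ _ eoo Soo.
have -> : series (a \o e) = (fun k => (-1) ^+ tau * (S \o e) k).
  by apply/funext => k; rewrite sumE /S /= mulrA -expr2 sqrr_sign mul1r.
case: tau @S Soo Seoo => S Soo Seoo; [right|left].
  apply/cvgNry; apply: cvg_trans Seoo; apply: near_eq_cvg; near=> k.
  by rewrite /= fctE expr1 mulN1r opprK.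
apply: cvg_trans Seoo; apply: near_eq_cvg; near=> k.
by rewrite expr0 mul1r.
Unshelve. all: by end_near. Qed.

(** * From signs to a subseries *)

(** The sum over a finite union of classes is the finite sum of the sums over the
classes. *)
Lemma cvg_series_classes {R : realType} {J : finType} (E : nat -> J)
    (P : pred J) (f : R^nat) :
  (forall j, P j -> cvgn (series (fun n => if E n == j then f n else 0))) ->
  cvgn (series (fun n => if P (E n) then f n else 0)).
Proof.
move=> cvgf.
have -> : series (fun n => if P (E n) then f n else 0) =
    \sum_(j | P j) series (fun n => if E n == j then f n else 0).
  apply/funext => N; rewrite fct_sumE /series /= exchange_big /=.
  apply: eq_bigr => n _; rewrite -big_mkcondr /=.
  case: ifPn => PE; last first.
    by rewrite big1 // => j /andP[Pj /eqP Ej]; rewrite Ej Pj in PE.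
  rewrite (big_pred1 (E n)) // => j /=; rewrite (eq_sym (E n)).
  by have [->|] := eqVneq j (E n); rewrite ?PE ?andbF.
elim/big_ind: _ => [|u u' cu cu'|j Pj]; [exact: is_cvg_cst|exact: is_cvgD|exact: cvgf].
Qed.

Lemma bounded_fun_ex {R : realType} (f : R^nat) :
  bounded_fun f -> exists B, forall n, `|f n| <= B.
Proof.
move=> [B [_ fB]]; exists (B + 1) => n.
by apply: (fB (B + 1)) => //; rewrite ltrDl.
Qed.

(** Round the weights [(1 + u) / 2]: their constant part contributes half of a
convergent series, hence a bounded amount. *)
Lemma round_signed_sum {R : realType} {d : nat} (a : 'I_d -> R^nat) (u : R^nat) :
  (forall i, cvgn (series (a i))) -> (forall n, `|u n| <= 1) ->
  exists (A : pred nat) (K : R), forall i N,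
    `|\sum_(0 <= n < N) (A n)%:R * a i n
      - 2^-1 * \sum_(0 <= n < N) u n * a i n| <= K.
Proof.
move=> cvga u1.
have [B aB] := choice (fun i => bounded_fun_ex _ (cvg_series_bounded (cvga i))).
have [L sL] := choice (fun i => bounded_fun_ex _ (cvg_seq_bounded (cvga i))).
have le_sum (X : 'I_d -> R) i : (forall i, 0 <= X i) -> X i <= \sum_i X i.
  by move=> X0; rewrite (bigD1 i) //= lerDl sumr_ge0.
have B0 i : 0 <= B i := le_trans (normr_ge0 _) (aB i 0%N).
have L0 i : 0 <= L i := le_trans (normr_ge0 _) (sL i 0%N).
pose w n := 2^-1 * (1 + u n).
have w01 n : 0 <= w n <= 1 by have := u1 n; rewrite /w ler_norml; lra.
have vM n j : `|(\row_i a i n : 'rV[R]_d) 0 j| <= \sum_i B i.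
  by rewrite mxE (le_trans (aB _ _)) // le_sum.
have [A AP] := prefix_rounding (fun n => \row_i a i n) w _ vM w01.
exists A, (d%:R * \sum_i B i + 2^-1 * \sum_i L i) => i N.
have -> : \sum_(0 <= n < N) (A n)%:R * a i n
      - 2^-1 * \sum_(0 <= n < N) u n * a i n =
    \sum_(0 <= n < N) ((A n)%:R - w n) * (\row_i a i n : 'rV[R]_d) 0 i
      + 2^-1 * series (a i) N.
  rewrite /series /= !mulr_sumr -sumrB -big_split /=; apply: eq_bigr => n _.
  by rewrite mxE /w; ring.
apply: le_trans (ler_normD _ _) _; rewrite lerD //.
by rewrite normrM gtr0_norm // ler_wpM2l // (le_trans (sL _ _)) // le_sum.
Qed.

(** [E n] is the sign pattern of the [n]th terms up to a global sign, normalized by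
the sign of coordinate 0.  With [u] built from a coherent choice of classes,
coordinate [i] of the signed sum is, up to the sign [tau i], at least one
infinite class sum minus the convergent sum over the classes where [i] does not
matter. *)
Lemma common_divergent_subseries {R : realType} (a : 'I_3 -> R^nat) :
  (forall i, conditionally_convergent (a i)) ->
  exists A : set nat, forall i, sends_to_infinity A (a i).
Proof.
move=> cca.
pose neg i n := a i n < 0.
pose E n := [ffun i => neg ord0 n (+) neg i n].
pose T i j : R^nat := series (fun n => if E n == j then `|a i n| else 0).
pose D j := [set i | ~~ `[< cvgn (T i j) >]]%SET.
have DP i j : i \notin D j -> cvgn (T i j) by rewrite inE negbK => /asboolP.
have T_infty i j : i \in D j -> T i j @ \oo --> +oo.
  rewrite inE => /asboolP; apply: nondecreasing_dvgn_lt.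
  by apply: nondecreasing_series => n _; case: ifP.
have cover i : exists j, i \in D j.
  apply: contrapT => noD; have [_] := cca i; apply.
  apply: (cvg_series_classes E predT (fun n => `|a i n|)) => j _.
  by apply: DP; apply/negP => iD; apply: noD; exists j.
have [C [b [tau [coh hit]]]] :=
  coherent_cover (fun (j : {ffun 'I_3 -> bool}) i => j i) D cover.
pose u n : R := if E n \in C then (-1) ^+ (b (E n) (+) neg ord0 n) else 0.
have u1 n : `|u n| <= 1.
  by rewrite /u; case: ifP; rewrite ?normr_sign ?normr0 ?ler01.
(* If [i] matters for the class of [n], then the term contributes [`|a i n|] or 0
   with the right sign; otherwise it costs at most [`|a i n|]. *)
have term i j n : j \in C -> i \in D j ->
    (if E n == j then `|a i n| else 0)
      - (if i \notin D (E n) then `|a i n| else 0)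
    <= (-1) ^+ tau i * (u n * a i n).
  move=> jC ij; have [iE|niE] := boolP (i \in D (E n)); rewrite /= ?subr0; last first.
    have /negbTE-> : E n != j by apply: contraNneq niE => ->.
    rewrite sub0r lerNl (le_trans (ler_norm _)) // normrN normrMsign normrM.
    by rewrite ler_piMl.
  rewrite /u; have [EC|EC] := boolP (E n \in C); last first.
    have /negbTE-> : E n != j by apply: contraNneq EC => ->.
    by rewrite mul0r mulr0.
  suff -> : (-1) ^+ tau i *
      ((-1) ^+ (b (E n) (+) neg ord0 n) * a i n) = `|a i n|.
    by case: ifP.
  rewrite -(coh i (E n) EC iE) ffunE [X in _ * (_ * X)]numEsign -/(neg i n).
  by rewrite !mulrA -!signr_addb;
    case: (b _) (neg ord0 n) (neg i n) => [] [] []; rewrite mul1r.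
have [A [K AK]] := round_signed_sum a u (fun i => (cca i).1) u1.
exists [set n | A n] => i; apply: (sends_to_infinity_signed _ _ (tau i)).
have [j jC ij] := hit i.
have [G GP] : exists G, forall N,
    `|series (fun n => if i \notin D (E n) then `|a i n| else 0) N| <= G.
  apply/bounded_fun_ex/cvg_seq_bounded.
  apply: (cvg_series_classes E (fun j => i \notin D j) (fun n => `|a i n|)).
  by move=> k; exact: DP.
have lower N : 2^-1 * T i j N - (2^-1 * G + K) <=
    (-1) ^+ tau i * \sum_(0 <= n < N) (A n)%:R * a i n.
  have : T i j N - G <= (-1) ^+ tau i * \sum_(0 <= n < N) u n * a i n.
    apply: (@le_trans _ _ (T i j N -
        series (fun n => if i \notin D (E n) then `|a i n| else 0) N)).
      by rewrite lerB // (le_trans (ler_norm _)).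
    by rewrite /T /series /= -sumrB mulr_sumr; apply: ler_sum => n _; exact: term.
  have := AK i N; rewrite ler_norml.
  by case: (tau i); rewrite ?expr1 ?expr0; lra.
apply/cvgryPge => x; near=> N.
have TN : 2 * (x + (2^-1 * G + K)) <= T i j N.
  by near: N; exact: (cvgryPge _).1 (T_infty i j ij) _.
by move: (lower N); lra.
Unshelve. all: by end_near. Qed.

Theorem mainTheorem1 (R : realType) (a1 a2 a3 : R^nat)
    (ha1 : conditionally_convergent a1)
    (ha2 : conditionally_convergent a2)
    (ha3 : conditionally_convergent a3) :
  exists A : set nat,
    [/\ sends_to_infinity A a1, sends_to_infinity A a2
      & sends_to_infinity A a3].
Proof.
have [|A AP] := common_divergent_subseries (tnth [tuple a1; a2; a3]).
  by case=> [[|[|[|]]]] // i; rewrite (tnth_nth a1).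
exists A; split.
- by have := AP (inord 0); rewrite (tnth_nth a1) inordK.
- by have := AP (inord 1); rewrite (tnth_nth a1) inordK.
- by have := AP (inord 2); rewrite (tnth_nth a1) inordK.
Qed.
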